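(* For any choice of $\{F_N\}_{N\in\mathbb{N}}\subseteq\mathbb{R}^+$ and $\delta:\mathbb{R}/\mathbb{Z}\times\mathbb{N}\to\{0,1\}$, the quantities $$\frac{1}{F_N}\left(\sum_{n=0}^{N-1}\left\lfloor\frac{1}{\{2^nx\}}\right\rfloor-\delta(x,N)\cdot\max_{0\le n<N}\left\lfloor\frac{1}{\{2^nx\}}\right\rfloor\right)$$ either diverge for a.e. $x\in\mathbb{R}/\mathbb{Z}$, or they converge to $0$ for a.e. $x\in\mathbb{R}/\mathbb{Z}$ (with respect to Lebesgue measure), as $N\to\infty$.
   Context: $\mathbb{N}=\{1,2,\dots\}$, $\mathbb{R}^+$ is the set of positive real numbers, $\{y\}$ denotes the fractional part of $y$ and $\lfloor y\rfloor$ the integer part of $y$. The quantities are defined for all $x$ outside the (Lebesgue null) set of dyadic rationals. *)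

(* Defs.v *)
From HB Require Import structures.
From mathcomp Require Import all_boot all_order all_algebra.
From mathcomp Require Import all_classical all_reals all_analysis.

Set Implicit Arguments.
Unset Strict Implicit.
Unset Printing Implicit Defensive.

Import Order.TTheory GRing.Theory Num.Theory.
Import numFieldNormedType.Exports.

Local Open Scope classical_set_scope.
Local Open Scope ring_scope.

Definition frac_part (R : realType) (y : R) : R := y - (Num.floor y)%:~R.

(* If x is a dyadic rational, {2^n x} = 0 for large n, and the value of
   1 / 0 = 0 is then a convention without meaning; this concerns a null set. *)
Definition term (R : realType) (x : R) (n : nat) : int :=
  Num.floor (1 / frac_part (2 ^+ n * x)).

(* All terms are nonnegative, so that the default value 0 does not affect the
   maximum when 0 < N. *)
Definition max_term (R : realType) (x : R) (N : nat) : int :=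
  \big[Num.max/0]_(n < N) term x n.

Definition trimmed_avg (R : realType) (F : nat -> R) (delta : R -> nat -> bool)
    (x : R) (N : nat) : R :=
  1 / F N *
    ((\sum_(n < N) term x n)%:~R - (delta x N)%:R * (max_term x N)%:~R).

(* Main.v *)
(* Let X_n be the n-th term, S_N the sum and M_N the maximum of
   X_0, ..., X_(N-1).
   A large term X_n is followed by X_(n+1) >= (X_n - 1) / 2, hence
   2 (S_(n+2) - M_(n+2)) + 1 >= X_n: trimming one term does not remove the
   influence of X_n once n + 2 terms are taken into account.

   If the series of 1 / (F_N + 1) diverges, the second Borel-Cantelli lemma for
   runs of zeros in the binary expansion shows that X_n / F_(n+2) is a.e.
   unbounded, and so are the trimmed averages, whatever delta is.

   If it converges, then F_N -> oo and X_(N-1) / F_N -> 0 a.e., and the bound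
   S_N <= 3 (S_N - M_N) + 1 + X_(N-1) shows that for a.e. x the trimmed averages
   tend to 0 iff S_N / F_N does.  No other limit is possible: comparison with
   the harmonic series yields infinitely many N such that F_N is much larger
   than N log N, and S_N / F_N tends to 0 in probability along them.  Finally,
   the set of all x such that S_N / F_N -> 0 is invariant under dyadic
   translations, hence null or conull by the Lebesgue density theorem. *)
Require Import Defs.
From HB Require Import structures.
From mathcomp Require Import all_boot all_order all_algebra.
From mathcomp Require Import all_classical all_reals all_analysis.
From mathcomp Require Import measurable_realfun zify ring lra.
Set Implicit Arguments.
Unset Strict Implicit.
Import Order.TTheory GRing.Theory Num.Theory.
Import numFieldNormedType.Exports.
Local Open Scope classical_set_scope.
Local Open Scope ring_scope.

(** * Lebesgue measure and dyadic intervals *)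

Lemma lebesgue_measure_translate (R : realType) (t : R) (A : set R) :
  measurable A -> lebesgue_measure [set x | A (x + t)] = lebesgue_measure A.
Proof.
move=> mA; transitivity (pushforward lebesgue_measure
  ((fun x => x + t) : measurableTypeR R -> measurableTypeR R) A) => //.
apply/esym/lebesgue_measure_unique => //=.
  exact: measurable_funD.
move=> _ _ [[a b]] _ <-; rewrite /pushforward.
have -> : (fun x : R => x + t) @^-1` `]a, b] = `]a - t, b - t]%classic.
  by apply/seteqP; split => x /=; rewrite !in_itv/= ltrBlDr lerBrDr.
rewrite !lebesgue_measure_itv/= !lte_fin ltrD2r; case: ifP => // _.
by rewrite -!EFinD; congr (_%:E); lra.
Qed.

(** The uniform distribution on [[0, 1[], kept as a measure on the whole line so that periodic sets
    can be measured without being cut down first. *)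
Definition unif (R : realType) : {measure set (measurableTypeR R) -> \bar R} :=
  mrestr (@lebesgue_measure R) (measurable_itv `[0, 1[).

Lemma unifE (R : realType) (A : set R) :
  unif R A = lebesgue_measure (A `&` `[0, 1[).
Proof. by []. Qed.

Lemma unifT (R : realType) : unif R setT = 1%E.
Proof.
by rewrite unifE setTI lebesgue_measure_itv/= lte_fin ltr01 oppr0 adde0.
Qed.

Lemma le_unif (R : realType) (A B : set R) : measurable A -> measurable B ->
  A `<=` B -> (unif R A <= unif R B)%E.
Proof. by move=> mA mB AB; rewrite le_measure ?inE. Qed.

Lemma unif_le1 (R : realType) (A : set R) : measurable A -> (unif R A <= 1)%E.
Proof. by move=> mA; rewrite -(unifT R) le_measure ?inE. Qed.

Lemma unif_fin (R : realType) (A : set R) :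
  measurable A -> unif R A \is a fin_num.
Proof.
by move=> mA; rewrite ge0_fin_numE// (le_lt_trans (unif_le1 mA)) ?ltry.
Qed.

Definition dyadic_itv (R : realType) (k j : nat) : set R :=
  [set x | Num.floor (2 ^+ k * x) = j%:Z].

Arguments dyadic_itv : clear implicits.

Lemma dyadic_itvE (R : realType) (k j : nat) :
  dyadic_itv R k j = `[j%:R / 2 ^+ k, j.+1%:R / 2 ^+ k[%classic.
Proof.
have k0 : 0 < 2 ^+ k :> R by rewrite exprn_gt0.
apply/seteqP; split => x; rewrite /dyadic_itv /= in_itv/=;
  rewrite ler_pdivrMr// ltr_pdivlMr// (mulrC x) -(natr1 j).
  by move=> e; have := floor_itv (2 ^+ k * x); rewrite e intrD.
by move=> h; apply: floor_def; rewrite intrD.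
Qed.

Lemma measurable_dyadic_itv (R : realType) (k j : nat) :
  measurable (dyadic_itv R k j).
Proof. by rewrite dyadic_itvE; exact: measurable_itv. Qed.

Lemma bigcup_dyadic_itv (R : realType) (k : nat) :
  \big[setU/set0]_(j < 2 ^ k) dyadic_itv R k j = `[0, 1[%classic.
Proof.
rewrite -bigcup_mkord.
apply/seteqP; split => x.
  move=> [j /= jk]; rewrite dyadic_itvE /= in_itv/= => /andP[h1 h2].
  rewrite in_itv/= (le_trans _ h1) ?divr_ge0//=.
  apply: (lt_le_trans h2); rewrite ler_pdivrMr ?exprn_gt0// mul1r.
  by rewrite -natrX ler_nat.
rewrite /= in_itv/= => /andP[x0 x1].
have p0 : 0 < 2 ^+ k :> R by rewrite exprn_gt0.
have : (0 <= Num.floor (2 ^+ k * x))%R by rewrite floor_ge0 mulr_ge0// ltW.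
have : Num.floor (2 ^+ k * x) < (2 ^ k)%:Z.
  by rewrite floor_lt_int -pmulrn natrX -[ltRHS]mulr1 ltr_pM2l.
case E : (Num.floor (2 ^+ k * x)) => [j|//] jk _; exists j => //=.
Qed.

Lemma trivIset_dyadic_itv (R : realType) (k : nat) :
  trivIset setT (dyadic_itv R k).
Proof.
apply/trivIsetP => i j _ _ /eqP ij; apply/seteqP; split => // x [].
by rewrite /dyadic_itv/= => -> [] /ij.
Qed.

Lemma unif_sum_dyadic_itv (R : realType) (k : nat) (A : set R) : measurable A ->
  unif R A = (\sum_(j < 2 ^ k) lebesgue_measure (A `&` dyadic_itv R k j))%E.
Proof.
move=> mA; rewrite unifE -(bigcup_dyadic_itv R k).
rewrite -bigcup_mkord setI_bigcupr bigcup_mkord.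
pose F j : set (measurableTypeR R) := A `&` dyadic_itv R k j.
rewrite -[LHS]/(lebesgue_measure (\big[setU/set0]_(j < 2 ^ k) F j)).
rewrite measure_bigsetU//.
  by move=> j; apply: measurableI => //; exact: measurable_dyadic_itv.
by apply: trivIset_setIl; exact: trivIset_dyadic_itv.
Qed.

(** * Periodic sets, cylinders and their independence *)

Definition periodic (R : realType) (t : R) (P : set R) :=
  forall x, P (x + t) <-> P x.

(** Such a set depends only on the integer part and the first [k] binary digits: it is a union of
    dyadic intervals of length [2 ^- k]. *)
Definition cylinder (R : realType) (k : nat) (A : set R) :=
  forall x y, Num.floor (2 ^+ k * x) = Num.floor (2 ^+ k * y) -> A x -> A y.

Lemma periodicM (R : realType) (t : R) (P : set R) (n : nat) :
  periodic t P -> periodic (t *+ n) P.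
Proof.
move=> hP; elim: n => [|n IH] x; first by rewrite mulr0n addr0.
by rewrite mulrS addrCA addrC; split=> [/hP/IH//|?]; apply/hP/IH.
Qed.

Lemma lebesgue_measure_periodic (R : realType) (k j : nat) (P : set R) :
  measurable P -> periodic (2 ^- k) P ->
  lebesgue_measure (P `&` dyadic_itv R k j) =
  lebesgue_measure (P `&` dyadic_itv R k 0).
Proof.
move=> mP hP.
rewrite -(lebesgue_measure_translate (2 ^- k *+ j)); last first.
  by apply: measurableI => //; exact: measurable_dyadic_itv.
congr lebesgue_measure; apply/seteqP.
have E x : dyadic_itv R k j (x + 2 ^- k *+ j) <-> dyadic_itv R k 0 x.
  rewrite /dyadic_itv/= mulrDr mulrnAr divff ?gt_eqF ?exprn_gt0//.
  rewrite floorDrz ?rpredMn ?rpred1// -[j%:R]/(j%:~R) intrKfloor.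
  by split=> [h|-> //]; apply: (addIr j%:Z); rewrite h add0r.
by split => x [/= hx Ix]; split; by [apply/E | apply/(periodicM j hP)].
Qed.

Lemma lebesgue_measure_dyadic_itv_fin (R : realType) (k j : nat) (P : set R) :
  measurable P -> lebesgue_measure (P `&` dyadic_itv R k j) \is a fin_num.
Proof.
move=> mP; have mI := @measurable_dyadic_itv R k j.
rewrite ge0_fin_numE//.
rewrite (@le_lt_trans _ _ (lebesgue_measure (dyadic_itv R k j)))//.
  by apply: le_measure; rewrite ?inE //=; first exact: measurableI.
by rewrite dyadic_itvE lebesgue_measure_itv/=; case: ifP => _; exact: ltry.
Qed.

Lemma unif_periodic (R : realType) (k : nat) (P : set R) :
  measurable P -> periodic (2 ^- k) P ->
  unif R P = ((2 ^+ k)%:E * lebesgue_measure (P `&` dyadic_itv R k 0))%E.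
Proof.
move=> mP pP; rewrite (unif_sum_dyadic_itv k mP).
under eq_bigr do rewrite lebesgue_measure_periodic//.
rewrite -(fineK (lebesgue_measure_dyadic_itv_fin k 0 mP)) -EFinM sumEFin.
by rewrite sumr_const card_ord -natrX mulr_natl.
Qed.

(** Independence of early and late digits: each dyadic interval of level [k] is contained in [A] or
    disjoint from it, as its left endpoint decides, while [P] has the same mass in all of them. *)
Lemma unif_cylinderI (R : realType) (k : nat) (A P : set R) :
  measurable A -> cylinder k A -> measurable P -> periodic (2 ^- k) P ->
  unif R (A `&` P) = (unif R A * unif R P)%E.
Proof.
move=> mA cA mP pP.
have p0 : 0 < 2 ^+ k :> R by rewrite exprn_gt0.
pose a j : R := (`[< A (j%:R / 2 ^+ k) >])%:R.
pose m Q := lebesgue_measure (Q `&` dyadic_itv R k 0).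
have aI Q j : measurable Q -> periodic (2 ^- k) Q ->
    lebesgue_measure (A `&` Q `&` dyadic_itv R k j) = ((a j)%:E * m Q)%E.
  move=> mQ pQ; rewrite /m -(lebesgue_measure_periodic j mQ pQ).
  have e : Num.floor (2 ^+ k * (j%:R / 2 ^+ k) : R) = j%:Z.
    by rewrite mulrC divfK ?gt_eqF// -[j%:R]/(j%:~R) intrKfloor.
  rewrite /a; case: asboolP => h.
    rewrite mul1e; congr lebesgue_measure; apply/seteqP.
    split => x [] //= => [[? ?] //|Qx Ix]; split => //; split => //.
    by apply: cA h; rewrite e Ix.
  rewrite mul0e (_ : A `&` Q `&` _ = set0) ?measure0//.
  apply/seteqP; split => // x [] [Ax _] Ix; apply: h.
  by apply: cA Ax; rewrite e Ix.
have AQ Q : measurable Q -> periodic (2 ^- k) Q ->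
    unif R (A `&` Q) = ((\sum_(j < 2 ^ k) a j)%:E * m Q)%E.
  move=> mQ pQ; rewrite (unif_sum_dyadic_itv k); last exact: measurableI.
  under eq_bigr do rewrite aI//.
  rewrite /m.
  rewrite -(fineK (lebesgue_measure_dyadic_itv_fin k 0 mQ)) -EFinM mulr_suml.
  by rewrite -sumEFin; apply: eq_bigr => j _; rewrite -EFinM.
(* [AQ] is used for [Q = P] and for [Q = setT]; the total mass 1 identifies [m setT] as the inverse
   of [2 ^+ k]. *)
have pT : periodic (2 ^- k) (setT : set R) by [].
rewrite AQ// -[X in (_ = unif R X * _)%E]setIT AQ//.
rewrite (unif_periodic mP pP) -/(m P).
have := unif_periodic measurableT pT; rewrite unifT -/(m setT) => e.
by rewrite -muleA (muleA (m setT)) (muleC (m setT)) -e mul1e.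
Qed.

(** Near a density point of [E] the complement has a small share of a ball of radius [2 ^- k], hence
    of a dyadic interval of length [2 ^- k] inside it. By periodicity it has the same share of [[0,
    1[]. *)
Lemma zero_one_periodic (R : realType) (E : set R) : measurable E ->
  (forall k, periodic (2 ^- k) E) -> unif R E = 0%E \/ unif R (~` E) = 0%E.
Proof.
move=> mE pE.
have [/eqP ->|E0] := boolP (unif R E == 0%E); [by left|right].
have mC : measurable (~` E) by exact: measurableC.
have pC k : periodic (2 ^- k) (~` E).
  by move=> x; split=> h1 h2; apply: h1; [exact/(pE k)|exact/(pE k)].
pose g x r := (lebesgue_measure (E `&` ball x r) *
  (lebesgue_measure (ball x r))^-1)%E.
have [x [[Ex x01] dx]] : exists x, (E `&` `[0, 1[) x /\
    g x r @[r --> 0^'+] --> (1%:E)%E.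
  (* If no point of [E] in [[0, 1[] were a density point, all of them would lie in the exceptional
     null set of the density theorem. *)
  have [N [mN N0 hN]] := lebesgue_density mE.
  apply: contrapT => /forallNP h; move/eqP: E0; apply.
  apply/eqP; rewrite eq_le measure_ge0 andbT -N0.
  apply: le_measure; rewrite ?inE//=; first exact: measurableI.
  move=> x [Ex x01]; apply: hN => /= hx; apply: (h x); split=> //.
  by move: hx; rewrite indicE mem_set.
move/fine_cvg : dx => dx.
(* The factor 2 is the ratio between the lengths of the ball and of the dyadic interval. *)
suff H (d : R) : 0 < d -> fine (unif R (~` E)) <= d *+ 2.
  apply/eqP; rewrite -(fineK (unif_fin mC)) eqe eq_le fine_ge0 ?measure_ge0//.
  rewrite andbT; apply/ler_addgt0Pl => d d0; rewrite addr0.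
  by rewrite [leRHS]splitr -mulr2n H ?divr_gt0.
move=> d0; move/cvgrPdist_lt : dx => /(_ _ d0).
move=> [r /= r0 hr].
have [k hk] : exists k : nat, 2 ^- k < r.
  have [k _ hk] := near_infty_natSinv_expn_lt (PosNum r0).
  by exists k; have := hk k (leqnn k); rewrite /= div1r.
have k0 : 0 < 2 ^- k :> R by rewrite invr_gt0 exprn_gt0.
have := hr (2 ^- k).
rewrite /= sub0r normrN gtr0_norm// => /(_ hk k0).
rewrite /g (lebesgue_measure_ball x (ltW k0)).
rewrite inver gt_eqF ?mulrn_wgt0// => h.
have mB : measurable (ball x (2 ^- k : R)) by exact: measurable_ball.
have abE : (lebesgue_measure (E `&` ball x (2 ^- k)) +
    lebesgue_measure (~` E `&` ball x (2 ^- k)) = (2 ^- k *+ 2)%:E)%E.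
  rewrite -(lebesgue_measure_ball x (ltW k0)) -measureU.
  - by rewrite -setIUl setUCr setTI.
  - exact: measurableI.
  - exact: measurableI.
  - by rewrite setIACA setICr set0I.
have [fa fb] : lebesgue_measure (E `&` ball x (2 ^- k)) \is a fin_num /\
    lebesgue_measure (~` E `&` ball x (2 ^- k)) \is a fin_num.
  by apply/andP; rewrite -fin_numD abE.
have [j hj] : exists j, dyadic_itv R k j x.
  move: x01; rewrite -(bigcup_dyadic_itv R k) -bigcup_mkord => -[j _ ?].
  by exists j.
have IB : dyadic_itv R k j `<=` ball x (2 ^- k).
  move=> y; move: hj; rewrite dyadic_itvE /= !in_itv/= -!natr1 !mulrDl !div1r.
  by rewrite /ball/= ltr_norml => /andP[? ?] /andP[? ?]; lra.
have bI : (lebesgue_measure (~` E `&` dyadic_itv R k 0) <=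
    lebesgue_measure (~` E `&` ball x (2 ^- k)))%E.
  rewrite -(lebesgue_measure_periodic j mC (pC k)).
  apply: le_measure; rewrite ?inE; last exact: setIS.
    by apply: measurableI => //; exact: measurable_dyadic_itv.
  exact: measurableI.
move: abE bI h; rewrite -(fineK fa) -(fineK fb).
set a := fine (lebesgue_measure (E `&` _)); set b := fine _.
rewrite -EFinM/= -EFinD => -[abE].
rewrite (unif_periodic mC (pC k)).
rewrite -(fineK (lebesgue_measure_dyadic_itv_fin k 0 mC)) lee_fin -EFinM /=.
set c := fine _ => cb; rewrite ltr_norml => /andP[_ h].
have {}h : (2 ^- k *+ 2 - a) < d * (2 ^- k *+ 2).
  have : (1 - a / (2 ^- k *+ 2)) * (2 ^- k *+ 2) < d * (2 ^- k *+ 2).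
    by rewrite ltr_pM2r// mulrn_wgt0.
  by rewrite mulrBl mul1r divfK// gt_eqF// mulrn_wgt0.
rewrite mulrC -ler_pdivlMr ?exprn_gt0// (le_trans cb)//.
by lra.
Qed.

(** * Trimmed sums *)

Lemma frac_part_ge0 (R : realType) (y : R) : 0 <= frac_part y.
Proof. by rewrite subr_ge0 floor_le. Qed.

Lemma frac_partD_int (R : realType) (y z : R) :
  z \is a Num.int -> frac_part (y + z) = frac_part y.
Proof.
move=> zi; rewrite /frac_part floorDrz// intrD.
by rewrite (floorK zi); ring.
Qed.

Lemma frac_part_double (R : realType) (y : R) :
  frac_part (2 * y) <= 2 * frac_part y.
Proof.
have : (2 * Num.floor y <= Num.floor (2 * y)).
  rewrite floor_ge_int intrM ler_pM2l//; exact: floor_le.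
by rewrite -(ler_int R) intrM /frac_part => h; lra.
Qed.

Lemma term_ge0 (R : realType) (x : R) (n : nat) : 0 <= term x n.
Proof. by rewrite floor_ge0 divr_ge0// frac_part_ge0. Qed.

Lemma sum_term_ge (R : realType) (x : R) (N i j : nat) :
  (i < N)%N -> (j < N)%N -> i != j ->
  term x i + term x j <= \sum_(n < N) term x n.
Proof.
move=> iN jN ij; rewrite (bigD1 (Ordinal iN))//= (bigD1 (Ordinal jN))//=.
  by rewrite addrA lerDl sumr_ge0// => n _; exact: term_ge0.
by rewrite -val_eqE/= eq_sym.
Qed.

Lemma sum_term_ge1 (R : realType) (x : R) (N i : nat) :
  (i < N)%N -> term x i <= \sum_(n < N) term x n.
Proof.
move=> iN; rewrite (bigD1 (Ordinal iN))//=.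
by rewrite lerDl sumr_ge0// => n _; exact: term_ge0.
Qed.

Lemma max_term_le (R : realType) (x : R) (N : nat) (c : int) : 0 <= c ->
  (forall n, (n < N)%N -> term x n <= c) -> max_term x N <= c.
Proof.
by move=> c0 h; apply: bigmax_le => // i _; exact: h.
Qed.

Lemma max_term_ge0 (R : realType) (x : R) (N : nat) : 0 <= max_term x N.
Proof. exact: bigmax_ge_id. Qed.

Lemma max_term_le_sum (R : realType) (x : R) (N : nat) :
  max_term x N <= \sum_(n < N) term x n.
Proof.
apply: max_term_le => [|n nN]; last exact: sum_term_ge1.
by apply: sumr_ge0 => n _; exact: term_ge0.
Qed.

Definition trimmed (R : realType) (x : R) (N : nat) : int :=
  \sum_(n < N) term x n - max_term x N.

Lemma trimmed_ge0 (R : realType) (x : R) (N : nat) : 0 <= trimmed x N.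
Proof. by rewrite subr_ge0 max_term_le_sum. Qed.

(** The maximum removes a single term, so one of the terms [i] and [j] survives in the trimmed
    sum. *)
Lemma trimmed_ge_min (R : realType) (x : R) (N i j : nat) :
  (i < N)%N -> (j < N)%N -> i != j ->
  Num.min (term x i) (term x j) <= trimmed x N.
Proof.
move=> iN jN ij; rewrite /trimmed lerBrDr -lerBrDl; apply: max_term_le.
  rewrite subr_ge0 (le_trans _ (sum_term_ge1 x iN))//.
  by rewrite ge_min lexx.
move=> n nN; rewrite lerBrDl.
have [->|ni] := eqVneq n i.
  rewrite addrC (le_trans _ (sum_term_ge x iN jN ij))// lerD2l.
  by rewrite ge_min lexx orbT.
by rewrite (le_trans _ (sum_term_ge x iN nN _)) 1?eq_sym// lerD2r ge_min lexx.
Qed.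

Definition nondyadic (R : realType) (x : R) :=
  forall n, frac_part (2 ^+ n * x) != 0.

(** Doubling the argument at most doubles the fractional part. Rounding gives a strict inequality
    with [+ 2], which between integers is the stated one. *)
Lemma term_succ (R : realType) (x : R) (n : nat) : nondyadic x ->
  term x n <= 2 * term x n.+1 + 1.
Proof.
move=> ndx; rewrite -ltzD1 -(ltr_int R) (le_lt_trans (floor_le _))//.
have f0 : 0 < frac_part (2 ^+ n * x) by rewrite lt_def ndx frac_part_ge0.
have f1 : 0 < frac_part (2 ^+ n.+1 * x) by rewrite lt_def ndx frac_part_ge0.
have : 1 / frac_part (2 ^+ n * x) <= 2 * (1 / frac_part (2 ^+ n.+1 * x)).
  rewrite ler_pdivrMr// mulrAC mulrA mulr1 ler_pdivlMr// mul1r.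
  by rewrite exprS -mulrA frac_part_double.
have := floorD1_gt (1 / frac_part (2 ^+ n.+1 * x)).
rewrite -/(term x n.+1) !intrD intrM => *; lra.
Qed.

Lemma term_le_trimmed (R : realType) (x : R) (N n : nat) : nondyadic x ->
  (n.+1 < N)%N -> term x n <= 2 * trimmed x N + 1.
Proof.
move=> ndx nN; have := term_succ n ndx; have := trimmed_ge0 x N.
have := trimmed_ge_min x (ltnW nN) nN (negbT (ltn_eqF (ltnSn n))).
rewrite ge_min; lia.
Qed.

(** Every term before the last has its successor in the sum and is controlled by [term_le_trimmed];
    the last one has no successor there and must be added separately. *)
Lemma sum_le_trimmed (R : realType) (x : R) (N : nat) : nondyadic x ->
  \sum_(n < N.+1) term x n <= 3 * trimmed x N.+1 + 1 + term x N.
Proof.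
move=> ndx; suff : max_term x N.+1 <= 2 * trimmed x N.+1 + 1 + term x N.
  rewrite -[X in _ -> X <= _](subrK (max_term x N.+1)) -/(trimmed x N.+1).
  by move: (trimmed _ _) (max_term _ _) (term _ _) => *; lia.
have := trimmed_ge0 x N.+1; have := term_ge0 x N => h1 h2.
apply: max_term_le; first lia.
move=> n; rewrite ltnS leq_eqVlt => /predU1P[->|nN]; first lia.
by have := @term_le_trimmed _ x N.+1 n ndx nN; lia.
Qed.

Lemma term_translate (R : realType) (x : R) (k n : nat) : (k <= n)%N ->
  term (x + 2 ^- k) n = term x n.
Proof.
move=> kn; rewrite /term mulrDr frac_partD_int//.
by rewrite -(subnK kn) exprD mulfK ?expf_neq0 ?rpredX ?natr_int.
Qed.

(** * Distribution of the terms and of the binary digits *)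

Lemma measurable_floor (R : realType) :
  measurable_fun [set: R] (fun x : R => (Num.floor x)%:~R : R).
Proof.
apply: nondecreasing_measurable => // x y xy.
by rewrite ler_int; exact: le_floor.
Qed.

Lemma measurable_frac_part (R : realType) :
  measurable_fun [set: R] (@frac_part R).
Proof. by apply: measurable_funB => //; exact: measurable_floor. Qed.

Lemma measurable_frac_part_pow2 (R : realType) (n : nat) :
  measurable_fun [set: R] (fun x : R => frac_part (2 ^+ n * x)).
Proof.
apply: (measurableT_comp (@measurable_frac_part R)).
exact: mulrl_measurable.
Qed.

Lemma measurable_term (R : realType) (n : nat) :
  measurable_fun [set: R] (fun x : R => (term x n)%:~R : R).
Proof.
(* The inverse becomes a real power, whose measurability is known; the two agree on nonnegative
   numbers, including at 0. *)
have -> : (fun x : R => (term x n)%:~R : R) =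
    (fun x : R => (Num.floor x)%:~R) \o (@powR R ^~ (-1)) \o
    (fun x : R => frac_part (2 ^+ n * x)).
  by apply/funext => x /=; rewrite /term div1r powR_inv1// frac_part_ge0.
apply: measurableT_comp; last exact: measurable_frac_part_pow2.
by apply: measurableT_comp; [exact: measurable_floor|exact: measurable_powR].
Qed.

Lemma measurable_sum_term (R : realType) (N : nat) :
  measurable_fun [set: R] (fun x : R => (\sum_(n < N) term x n)%:~R : R).
Proof.
under eq_fun do rewrite raddf_sum/=.
by apply: measurable_sum => n; exact: measurable_term.
Qed.

Lemma measurable_ge (R : realType) (f : R -> R) (a : R) :
  measurable_fun [set: R] f -> measurable [set x | a <= f x].
Proof.
move=> mf; have := mf measurableT _ (measurable_itv `[a, +oo[).
rewrite setTI (_ : _ @^-1` _ = [set x | a <= f x])//.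
by apply/seteqP; split=> x /=; rewrite in_itv/= andbT.
Qed.

Lemma periodic_frac_part (R : realType) (n : nat) (P : R -> Prop) :
  periodic (2 ^- n) [set x | P (frac_part (2 ^+ n * x))].
Proof.
by move=> x /=; rewrite mulrDr divff ?expf_neq0// frac_partD_int.
Qed.

(** By periodicity only the first dyadic interval of level [n] matters. There [frac_part] is the
    identity on [2 ^+ n * x], and the event forces [2 ^+ n * x <= a^-1]. *)
Lemma unif_term_ge (R : realType) (n : nat) (a : R) : 0 < a ->
  (unif R [set x | (a <= (term x n)%:~R)%R] <= (a^-1)%:E)%E.
Proof.
move=> a0; have p0 : 0 < 2 ^+ n :> R by rewrite exprn_gt0.
have mA := measurable_ge a (@measurable_term R n).
rewrite (@unif_periodic R n _ mA); last first.
  exact: (@periodic_frac_part R n (fun y => a <= (Num.floor (1 / y))%:~R)).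
pose J : set R := `[0, a^-1 / 2 ^+ n]%classic.
rewrite (@le_trans _ _ ((2 ^+ n)%:E * lebesgue_measure J)%E)//.
  rewrite lee_pmul2l// ?lte_fin//; apply: le_measure; rewrite ?inE//.
    by apply: measurableI => //; exact: measurable_dyadic_itv.
    exact: measurable_itv.
  move=> x [/= ax Ix]; rewrite /J/= in_itv/=.
  have fx : frac_part (2 ^+ n * x) = 2 ^+ n * x by rewrite /frac_part Ix subr0.
  have x0 : 0 <= 2 ^+ n * x by rewrite -fx frac_part_ge0.
  rewrite -(pmulr_rge0 _ p0) x0/= ler_pdivlMr// mulrC.
  have := le_trans ax (floor_le _); rewrite fx div1r.
  (* At [2 ^+ n * x = 0] the convention [0^-1 = 0] makes the term 0, which contradicts [0 < a]. *)
  move: x0; rewrite le_eqVlt => /predU1P[<-|x0].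
    by rewrite invr0 leNgt a0.
  by move=> ?; rewrite -[leLHS]invrK lef_pV2// posrE invr_gt0.
rewrite lebesgue_measure_itv/= lte_fin divr_gt0 ?invr_gt0// oppr0 adde0.
by rewrite -EFinM mulrC divfK ?gt_eqF.
Qed.

(* The binary digit [N] of [x] is 1 and the next [l] digits are 0; digit 0 is
   the first one after the binary point. *)
Definition run (R : realType) (N l : nat) : set R :=
  [set x | 2^-1 <= frac_part (2 ^+ N * x) < 2^-1 + 2 ^- l.+1].
Arguments run : clear implicits.

Lemma periodic_run (R : realType) (N l : nat) : periodic (2 ^- N) (run R N l).
Proof.
exact: (@periodic_frac_part R N (fun y => 2^-1 <= y < 2^-1 + 2 ^- l.+1)).
Qed.

Lemma measurable_run (R : realType) (N l : nat) : measurable (run R N l).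
Proof.
have := measurable_frac_part_pow2 N measurableT
  (measurable_itv `[2^-1 : R, 2^-1 + 2 ^- l.+1[).
by rewrite setTI.
Qed.

Lemma unif_run (R : realType) (N l : nat) : unif R (run R N l) = (2 ^- l.+1)%:E.
Proof.
have p0 : 0 < 2 ^+ N :> R by rewrite exprn_gt0.
have q0 : 0 < 2 ^- l.+1 :> R by rewrite invr_gt0 exprn_gt0.
have q1 : 2 ^- l.+1 <= 2^-1 :> R.
  rewrite exprS invfM ler_piMr ?invr_ge0// invf_le1 ?exprn_gt0//.
  by rewrite exprn_ege1 ?ler1n.
rewrite (unif_periodic (@measurable_run R N l) (@periodic_run R N l)).
have -> : run R N l `&` dyadic_itv R N 0 =
    `[2^-1 / 2 ^+ N, (2^-1 + 2 ^- l.+1) / 2 ^+ N[%classic.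
  apply/seteqP; split=> x.
    rewrite /run /dyadic_itv /= in_itv/= /frac_part => -[+ Ix].
    by rewrite Ix subr0 ler_pdivrMr// ltr_pdivlMr// mulrC.
  rewrite /run /dyadic_itv /= in_itv/= ler_pdivrMr// ltr_pdivlMr// mulrC.
  move=> h; have e : Num.floor (2 ^+ N * x) = 0.
    by apply: floor_def; move: h => /andP[h1 h2]; apply/andP; split; lra.
  by rewrite /frac_part e subr0.
rewrite lebesgue_measure_itv/= lte_fin ltr_pM2r ?invr_gt0// ltrDl q0.
rewrite -EFinD -EFinM -mulrBl mulrC divfK ?gt_eqF//.
by rewrite addrAC subrr add0r.
Qed.

(** Fewer digits are determined by more digits: [2 ^+ (m - k) * Num.floor (2 ^+ k * x)] is an
    integer below [2 ^+ m * x], hence below the common floor. Equality follows by exchanging [x] and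
    [y]. *)
Lemma floor_pow2_le (R : realType) (k m : nat) (x y : R) : (k <= m)%N ->
  Num.floor (2 ^+ m * x) = Num.floor (2 ^+ m * y) ->
  Num.floor (2 ^+ k * x) <= Num.floor (2 ^+ k * y).
Proof.
move=> km e; have p0 : 0 < 2 ^+ (m - k) :> R by rewrite exprn_gt0.
rewrite floor_ge_int -(ler_pM2l p0) mulrA -exprD subnK//.
have E : (2 ^+ (m - k) * Num.floor (2 ^+ k * x))%:~R =
    2 ^+ (m - k) * (Num.floor (2 ^+ k * x))%:~R :> R by rewrite intrM rmorphXn.
rewrite -E -floor_ge_int -e floor_ge_int E -(subnK km) addnK exprD -mulrA.
by rewrite ler_pM2l// floor_le.
Qed.

Lemma cylinderW (R : realType) (k m : nat) (A : set R) : (k <= m)%N ->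
  cylinder k A -> cylinder m A.
Proof.
move=> km cA x y e; apply: cA; apply/le_anti.
by rewrite (floor_pow2_le km e) (floor_pow2_le km (esym e)).
Qed.

Lemma cylinder_run (R : realType) (N l : nat) :
  cylinder (N + l.+1) (run R N l).
Proof.
move=> x y e.
have eN : Num.floor (2 ^+ N * x) = Num.floor (2 ^+ N * y).
  apply/le_anti; rewrite (floor_pow2_le (leq_addr _ _) e).
  by rewrite (floor_pow2_le (leq_addr _ _) (esym e)).
have p0 : 0 < 2 ^+ l.+1 :> R by rewrite exprn_gt0.
(* In binary, [m] is [Num.floor (2 ^+ N * x)] followed by the digit 1 and [l] digits 0. *)
pose m : int := 2 ^+ l.+1 * Num.floor (2 ^+ N * x) + 2 ^+ l.
have E (z : R) :
    (2^-1 <= 2 ^+ N * z - (Num.floor (2 ^+ N * x))%:~R < 2^-1 + 2 ^- l.+1) =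
    (Num.floor (2 ^+ (N + l.+1) * z) == m).
  rewrite floor_eq /m !intrD intrM !rmorphXn/=.
  have e1 : 2 ^+ l.+1 * 2^-1 = 2 ^+ l :> R.
    by rewrite exprS mulrAC divff// mul1r.
  have e2 : 2 ^+ l.+1 * 2 ^- l.+1 = 1 :> R by rewrite divff// gt_eqF.
  have e3 : 2 ^+ (N + l.+1) * z = 2 ^+ l.+1 * (2 ^+ N * z).
    by rewrite addnC exprD mulrA.
  rewrite -(ler_pM2l p0 2^-1) -(ltr_pM2l p0 _ (2^-1 + _)).
  rewrite mulrBr mulrDr e1 e2 e3.
  by apply/idP/idP => /andP[h1 h2]; apply/andP; split; lra.
by rewrite /run /= /frac_part -eN !E e.
Qed.

(** Shifting past the digit 1 and [i] of the zeros leaves [l - i] zeros in front. *)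
Lemma run_frac_part (R : realType) (N l i : nat) (x : R) : (i <= l)%N ->
  run R N l x -> frac_part (2 ^+ (N + i.+1) * x) < 2 ^+ i / 2 ^+ l.
Proof.
move=> il; rewrite /run /= {1 2}/frac_part => /andP[h1 h2].
have p0 : 0 < 2 ^+ i.+1 :> R by rewrite exprn_gt0.
have e1 : 2 ^+ i.+1 * 2^-1 = 2 ^+ i :> R by rewrite exprS mulrAC divff// mul1r.
have e2 : 2 ^+ i.+1 * 2 ^- l.+1 = 2 ^+ i / 2 ^+ l :> R.
  by rewrite !exprS invfM mulrACA divff// mul1r.
have e3 : 2 ^+ (N + i.+1) * x = 2 ^+ i.+1 * (2 ^+ N * x).
  by rewrite addnC exprD mulrA.
have e4 : 2 ^+ i / 2 ^+ l <= 1 :> R.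
  by rewrite ler_pdivrMr ?exprn_gt0// mul1r ler_eXn2l// ltr1n.
move: h1 h2; rewrite -(ler_pM2l p0) -(ltr_pM2l p0) mulrBr mulrDr e1 e2 -e3.
set f := Num.floor (2 ^+ N * x) => h1 h2.
suff e : Num.floor (2 ^+ (N + i.+1) * x) = 2 ^+ i.+1 * f + 2 ^+ i.
  by rewrite /frac_part e intrD intrM !rmorphXn/=; lra.
by apply: floor_def; rewrite !intrD intrM !rmorphXn/=; apply/andP; split; lra.
Qed.

Lemma run_term_ge (R : realType) (N l : nat) (x : R) : nondyadic x ->
  run R N l x -> 2 ^+ l <= term x N.+1.
Proof.
move=> ndx rx; have := run_frac_part (leq0n l) rx.
rewrite addn1 expr0 div1r => h; rewrite floor_ge_int rmorphXn/= div1r.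
rewrite -[leLHS]invrK lef_pV2 ?posrE ?invr_gt0 ?exprn_gt0//; first exact: ltW.
by rewrite lt_def ndx frac_part_ge0.
Qed.

(** The run at [N] makes the digit [M] equal to 0, whereas a run at [M] starts with 1. *)
Lemma run_disjoint (R : realType) (N l M m : nat) (x : R) :
  (N < M)%N -> (M <= N + l)%N -> run R N l x -> ~ run R M m x.
Proof.
move=> NM Ml rx.
have [i e] : exists i, M = (N + i.+1)%N by exists (M - N).-1; lia.
have il : (i.+1 <= l)%N by lia.
have := run_frac_part (ltnW il) rx; rewrite -e /run/= => h /andP[+ _].
apply/negP; rewrite -ltNge (lt_le_trans h)//.
by rewrite ler_pdivrMr ?exprn_gt0// ler_pdivlMl// -exprS ler_eXn2l// ltr1n.
Qed.

(** * Divergent case *)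

Definition no_run (R : realType) (l : nat -> nat) (D : set nat) : set R :=
  \bigcap_(i in D) ~` run R i (l i).
Arguments no_run : clear implicits.

Lemma measurable_no_run (R : realType) (l : nat -> nat) (D : set nat) :
  measurable (no_run R l D).
Proof.
apply: bigcap_measurableType => i _; apply: measurableC.
exact: measurable_run.
Qed.

(* A run starting at [N] forces the digits [N, N + l N], so it excludes the runs
   of [i < N] with [N <= i + l i]; the absence of the other ones only depends on
   the digits before [N], and is therefore independent of the run at [N]. *)
Lemma unif_no_runS (R : realType) (l : nat -> nat) (N : nat) :
  (unif R (no_run R l `I_N.+1) + unif R (no_run R l `I_N) * (2 ^- (l N).+1)%:E
    <= unif R (no_run R l `I_N))%E.
Proof.
have mno D := @measurable_no_run R l D.
pose A := no_run R l [set i | (i + l i < N)%N].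
have cA : cylinder N A.
  move=> x y e Ax i iN /= ry; apply: (Ax i iN).
  by apply: cylinderW (esym e) ry; last exact: cylinder_run; rewrite addnS.
have noA : no_run R l `I_N `<=` A.
  by move=> x h i iN; apply: h; rewrite /= (leq_ltn_trans _ iN)// leq_addr.
have AE : no_run R l `I_N `&` run R N (l N) = A `&` run R N (l N).
  apply/seteqP; split=> x [h rx]; split=> //; first exact: noA.
  move=> i /= iN ri.
  have [iNl|Nil] := ltnP (i + l i) N; first exact: (h i).
  exact: run_disjoint iN Nil ri rx.
have noS : no_run R l `I_N.+1 = no_run R l `I_N `\` run R N (l N).
  apply/seteqP; split=> x.
    by move=> h; split=> [i iN|]; apply: h => //=; rewrite ltnW.
  by move=> [h hN] i /=; rewrite ltnS leq_eqVlt => /predU1P[->//|iN]; apply: h.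
have mr := @measurable_run R N (l N).
have E : unif R (no_run R l `I_N) =
    (unif R (no_run R l `I_N.+1) + unif R A * (2 ^- (l N).+1)%:E)%E.
  rewrite -(@unif_run R N).
  rewrite -(unif_cylinderI (mno _) cA mr (@periodic_run R N (l N))).
  by rewrite -AE noS; apply/(measureDI (unif R) (mno _) mr).
rewrite [leRHS]E leeD2l// lee_pmul2r// ?lte_fin ?invr_gt0 ?exprn_gt0//.
exact: (le_unif (mno _) (mno _) noA).
Qed.

(** A quantitative second Borel-Cantelli lemma. With [s] the sum so far and [p] the new summand, the
    measure shrinks at least by the factor [1 - p], and [(1 - p) * (1 + s + p) <= 1 + s]. *)
Lemma unif_no_run_le (R : realType) (l : nat -> nat) (N : nat) :
  (unif R (no_run R l `I_N) * (1 + \sum_(i < N) 2 ^- (l i).+1)%:E <= 1)%E.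
Proof.
have mno D := @measurable_no_run R l D.
elim: N => [|N IH]; first by rewrite big_ord0 addr0 mule1 unif_le1.
have -> : \sum_(i < N.+1) 2 ^- (l i).+1 =
    \sum_(i < N) 2 ^- (l i).+1 + 2 ^- (l N).+1 :> R by rewrite big_ord_recr.
have := unif_no_runS R l N; move: IH.
rewrite -(fineK (unif_fin (mno `I_N))) -(fineK (unif_fin (mno `I_N.+1))).
rewrite -!EFinM -EFinD !lee_fin.
set s := \sum_(i < N) _; set p := _^-1; set q := fine _; set q' := fine _.
move=> IH q1.
have p0 : 0 <= p by rewrite invr_ge0 exprn_ge0.
have s0 : 0 <= s by apply: sumr_ge0 => i _; rewrite invr_ge0 exprn_ge0.
have q0 : 0 <= q by rewrite fine_ge0.
have {}q1 : q' <= q - q * p by lra.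
have s1 : 0 <= 1 + (s + p) by lra.
have qps : 0 <= q * p * (s + p) by rewrite !mulr_ge0// addr_ge0.
by rewrite (le_trans (ler_wpM2r s1 q1))//; lra.
Qed.

Lemma unif_no_run_eq0 (R : realType) (l : nat -> nat) :
  (forall c : R, exists n, c < \sum_(i < n) 2 ^- (l i).+1) ->
  unif R (no_run R l setT) = 0%E.
Proof.
have mno D := @measurable_no_run R l D.
move=> div.
suff H (e : R) : 0 < e -> fine (unif R (no_run R l setT)) <= e.
  apply/eqP; rewrite -(fineK (unif_fin (mno setT))) eqe eq_le fine_ge0// andbT.
  by apply/ler_addgt0Pl => d d0; rewrite addr0 H.
move=> e0; have [n hn] := div e^-1.
have := unif_no_run_le R l n.
have : (unif R (no_run R l setT) <= unif R (no_run R l `I_n))%E.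
  by apply: le_unif => // x h i _; exact: h.
rewrite -(fineK (unif_fin (mno setT))) -(fineK (unif_fin (mno `I_n))).
rewrite lee_fin -EFinM lee_fin => le1 le2.
have s0 : 0 < 1 + \sum_(i < n) 2 ^- (l i).+1 :> R.
  by rewrite ltr_pwDl// sumr_ge0// => i _; rewrite invr_ge0 exprn_ge0.
rewrite -ler_pdivlMr// in le2.
rewrite (le_trans le1)// (le_trans le2)// div1r -[leRHS]invrK.
rewrite lef_pV2 ?posrE ?invr_gt0//; lra.
Qed.

Lemma ae_unif_eq0 (R : realType) (N : set R) : measurable N ->
  unif R N = 0%E ->
  {ae @lebesgue_measure R, forall x : R, x \in `[0, 1[ -> ~ N x}.
Proof.
move=> mN N0; exists (N `&` `[0, 1[); split => //.
  exact: measurableI.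
by move=> x /= /existsNP[x01] /contrapT.
Qed.

Lemma ae_imp2 (R : realType) (P Q S : R -> Prop) :
  {ae @lebesgue_measure R, forall x, P x} ->
  {ae @lebesgue_measure R, forall x, Q x} ->
  (forall x, P x -> Q x -> S x) -> {ae @lebesgue_measure R, forall x, S x}.
Proof.
move=> hP hQ PQS; have ? := ae_filter_ringOfSetsType (@lebesgue_measure R).
exact: filterS2 PQS hP hQ.
Qed.

Lemma ae_imp (R : realType) (P Q : R -> Prop) :
  {ae @lebesgue_measure R, forall x, P x} ->
  (forall x, P x -> Q x) -> {ae @lebesgue_measure R, forall x, Q x}.
Proof. by move=> hP PQ; apply: (ae_imp2 hP hP) => x + _; exact: PQ. Qed.

Lemma ae_foralln (R : realType) (P : nat -> R -> Prop) :
  (forall n, {ae @lebesgue_measure R, forall x, P n x}) ->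
  {ae @lebesgue_measure R, forall x, forall n, P n x}.
Proof.
move=> h; have := negligible_bigcup h; apply: negligibleS.
by move=> x /= /existsNP[n hn]; exists n.
Qed.

Lemma ae_nondyadic (R : realType) :
  {ae @lebesgue_measure R, forall x : R, x \in `[0, 1[ -> nondyadic x}.
Proof.
suff : {ae @lebesgue_measure R, forall x (n : nat), x \in `[0, 1[ ->
    ~ frac_part (2 ^+ n * x) = 0}.
  by move/ae_imp; apply=> x h x01 n; apply/eqP; exact: h.
apply: ae_foralln => n; pose D : set R := [set x | frac_part (2 ^+ n * x) = 0].
have mD : measurable D.
  have := measurable_frac_part_pow2 n measurableT (measurable_set1 (0 : R)).
  by rewrite setTI.
apply: (ae_unif_eq0 mD).
rewrite (unif_periodic mD (@periodic_frac_part R n (fun y => y = 0))).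
rewrite (_ : D `&` _ = [set 0]) ?lebesgue_measure_set1 ?mule0//.
apply/seteqP; split=> x.
  rewrite /D /dyadic_itv /= => -[+ Ix]; rewrite /frac_part Ix subr0 => /eqP.
  by rewrite mulf_eq0 gt_eqF ?exprn_gt0//= => /eqP.
by move=> /= ->; rewrite /D /dyadic_itv /= mulr0 /frac_part floor0 subr0.
Qed.

Lemma pow2_between (R : realType) (y : R) : 1 <= y ->
  exists l : nat, y <= 2 ^+ l <= 2 * y.
Proof.
move=> y1; have ex : exists l : nat, y <= 2 ^+ l.
  exists (Num.truncn y).+1; rewrite (le_trans (ltW (truncnS_gt y)))//.
  by rewrite -natrX ler_nat ltnW// ltn_expl.
case: (ex_minnP ex) => -[|l] hl min.
  by exists 0%N; rewrite hl expr0; lra.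
exists l.+1; rewrite hl exprS ler_pM2l//= leNgt; apply/negP => /ltW /min.
by rewrite ltnn.
Qed.

(** Together with [trimmed_avg_le], this eliminates [delta]: the extreme cases are trimming always
    and trimming never. *)
Lemma trimmed_avg_ge (R : realType) (F : nat -> R) delta (x : R) (N : nat) :
  0 < F N -> (trimmed x N)%:~R / F N <= trimmed_avg F delta x N.
Proof.
move=> FN; rewrite /trimmed_avg mulrC div1r ler_pM2l ?invr_gt0//.
rewrite intrB lerB//; case: (delta x N); first by rewrite mul1r.
by rewrite mul0r ler0z max_term_ge0.
Qed.

Lemma trimmed_avg_le (R : realType) (F : nat -> R) delta (x : R) (N : nat) :
  0 < F N -> trimmed_avg F delta x N <= (\sum_(n < N) term x n)%:~R / F N.
Proof.
move=> FN; rewrite /trimmed_avg [leRHS]mulrC div1r ler_pM2l ?invr_gt0//.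
by rewrite gerBl mulr_ge0// ler0z max_term_ge0.
Qed.

Lemma ae_term_large (R : realType) (G : nat -> R) (K : nat) :
  (forall n, 1 <= G n) ->
  (forall c : R, exists n, c < \sum_(i < n) (G i)^-1) ->
  {ae @lebesgue_measure R, forall x : R, x \in `[0, 1[ ->
    exists n, K.+1%:R * G n.+2 <= (term x n.+1)%:~R}.
Proof.
move=> G1 div.
have KG n : 1 <= K.+1%:R * G n.
  by rewrite -[leLHS]mulr1 ler_pM// ler1n.
(* A run at [n] of this length makes [term x n.+1] large enough. The upper bound on [2 ^+ l] keeps
   the probabilities at least [(4 * K.+1%:R * G n.+2)^-1], so their series still diverges. *)
have /choice[l hl] n : exists l : nat,
    K.+1%:R * G n.+2 <= 2 ^+ l <= 2 * (K.+1%:R * G n.+2).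
  exact: pow2_between.
have G0 n : 0 < G n by rewrite (lt_le_trans ltr01).
have divl (c : R) : exists n, c < \sum_(i < n) 2 ^- (l i).+1.
  (* The first two summands are set aside because of the index shift in [G n.+2]. If [n <= 2], the
     inequality forces [c < 0], and the empty sum will do. *)
  have [n] := div (\sum_(i < 2) (G i)^-1 + 4 * K.+1%:R * c).
  case: (leqP n 2) => [n2 h|/ltnW n2 h].
  - exists 0%N; rewrite big_ord0 ltNge; apply/negP => c0.
    move: h; apply/negP; rewrite -leNgt.
    rewrite -[leLHS]addr0 lerD//; last by rewrite !mulr_ge0.
    rewrite -(subnKC n2) big_split_ord/= lerDl sumr_ge0// => i _.
    by rewrite invr_ge0 ltW.
  - have [k nk] : exists k, n = (2 + k)%N by exists (n - 2)%N; rewrite subnKC.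
    exists k; move: h; rewrite nk big_split_ord/= ltrD2l.
    rewrite -ltr_pdivlMl; last by rewrite mulr_gt0.
    move=> /lt_le_trans; apply; rewrite mulr_sumr; apply: ler_sum => i _.
    rewrite -invfM lef_pV2 ?posrE ?mulr_gt0 ?exprn_gt0// exprS.
    by have /andP[_] := hl i; rewrite addSn addSn add0n => ?; lra.
have := ae_unif_eq0 (@measurable_no_run R l setT) (unif_no_run_eq0 divl).
move=> H; apply: (ae_imp2 H (@ae_nondyadic R)) => x h ndx x01.
have /existsNP[n /not_implyP[_ /contrapT rx]] := h x01.
exists n; have /andP[hn _] := hl n; rewrite (le_trans hn)//.
by have := run_term_ge (ndx x01) rx; rewrite -(ler_int R) rmorphXn.
Qed.

Lemma ae_diverge (R : realType) (F : nat -> R) (delta : R -> nat -> bool) :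
  (forall N, (0 < N)%N -> 0 < F N) ->
  (forall c : R, exists n, c < \sum_(i < n) (F i.+1 + 1)^-1) ->
  {ae @lebesgue_measure R, forall x : R, x \in `[0, 1[ ->
     ~ cvg (trimmed_avg F delta x @ \oo)}.
Proof.
move=> F0 div.
(* The added 1 gives the lower bound that [ae_term_large] requires and later pays for the additive
   constant in [term_le_trimmed]. *)
pose G n := F n.+1 + 1.
have G1 n : 1 <= G n by rewrite lerDr ltW// F0.
have := ae_foralln (fun K => @ae_term_large R G K G1 div).
move=> H; apply: (ae_imp2 H (@ae_nondyadic R)) => x h ndx x01 /cvg_seq_bounded.
move=> [M [Mr hM]].
have {}hM n : `|trimmed_avg F delta x n| <= M + 1.
  by apply: (hM (M + 1)); rewrite ?ltrDl.
(* The factor 2 is the one lost in [term_le_trimmed]; the index [n.+3] below is the first for which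
   the sum contains the successor of the term [n.+1]. *)
have [K hK] : exists K : nat, 2 * (M + 1) < K.+1%:R.
  by exists (Num.truncn (2 * (M + 1))); rewrite truncnS_gt.
have [n hn] := h K x01.
have FN : 0 < F n.+3 by exact: F0.
have := le_trans (ler_norm _) (hM n.+3).
apply/negP; rewrite -ltNge; apply: lt_le_trans (trimmed_avg_ge delta x FN).
rewrite ltr_pdivlMr//.
have := @term_le_trimmed _ x n.+3 n.+1 (ndx x01) (ltnSn _).
rewrite -(ler_int R) intrD intrM => ht.
have : 2 * (M + 1) * F n.+3 < K.+1%:R * F n.+3 by rewrite ltr_pM2r.
have : 1 <= K.+1%:R :> R by rewrite ler1n.
by move: hn; rewrite /G mulrDr mulr1 => *; lra.
Qed.

(** * Convergent case *)

(** The first Borel-Cantelli lemma, with summability expressed by bounded partial sums. *)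
Lemma ae_eventually_not (R : realType) (A : nat -> set R) (b : nat -> R)
    (C : R) :
  (forall n, measurable (A n)) ->
  (forall n, (unif R (A n) <= (b n)%:E)%E) ->
  (forall n, \sum_(i < n) b i <= C) ->
  {ae @lebesgue_measure R, forall x : R, x \in `[0, 1[ ->
    exists m, forall n, (m <= n)%N -> ~ A n x}.
Proof.
move=> mA Ab bC.
have b0 n : 0 <= b n by rewrite -lee_fin (le_trans _ (Ab n)).
have mL : measurable (lim_sup_set A).
  by apply: bigcap_measurableType => n _; apply: bigcup_measurable => k _.
have L0 : unif R (lim_sup_set A) = 0%E.
  apply: lim_sup_set_cvg0 => //.
  apply: (@le_lt_trans _ _ C%:E); last exact: ltry.
  apply: lime_le; first by apply: is_cvg_nneseries => n _ _; exact: measure_ge0.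
  apply: nearW => n; apply: (@le_trans _ _ (\sum_(0 <= i < n) (b i)%:E)%E).
    by apply: lee_sum => i _; exact: Ab.
  by rewrite sumEFin lee_fin big_mkord bC.
apply: (ae_imp (ae_unif_eq0 mL L0)) => x h x01.
have /existsNP[m hm] := h x01; exists m => n mn An.
by apply: hm => _; exists n.
Qed.

Lemma unif_markov (R : realType) (I : finType) (w : I -> R) (E : I -> set R)
    (a : R) :
  0 < a -> (forall i, 0 <= w i) -> (forall i, measurable (E i)) ->
  (a%:E * unif R [set x | (a <= \sum_i w i * \1_(E i) x)%R] <=
    \sum_i (w i)%:E * unif R (E i))%E.
Proof.
move=> a0 w0 mE.
pose f x := (\sum_i (w i * \1_(E i) x)%:E)%E.
have mf1 i : measurable_fun [set: R] (fun x => (w i * \1_(E i) x)%:E).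
  apply/measurable_EFinP.
  by apply: measurable_funM => //; exact: measurable_indic.
have mi i : measurable_fun [set: R] (fun x => (\1_(E i) x)%:E : \bar R).
  by apply/measurable_EFinP; exact: measurable_indic.
have f10 i x : (0 <= (w i * \1_(E i) x)%:E)%E by rewrite lee_fin mulr_ge0.
have mf : measurable_fun [set: R] f by apply: emeasurable_sum.
have := @le_integral_abse _ _ _ (unif R) setT measurableT f a mf a0.
have f0 x : `|f x|%E = f x by rewrite gee0_abs// sume_ge0.
under eq_integral do rewrite f0.
rewrite ge0_integral_sum//.
have -> : setT `&` [set x | (a%:E <= `|f x|)%E] =
    [set x | a <= \sum_i w i * \1_(E i) x].
  by rewrite setTI; apply/seteqP; split=> x /=; rewrite f0 /f sumEFin lee_fin.
move/le_trans; apply; apply: lee_sum => i _.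
under eq_integral do rewrite EFinM.
rewrite ge0_integralZl_EFin//.
- rewrite integral_indic; last exact: mE.
  by rewrite (setIT (E i : set (measurableTypeR R))).
- exact: measurableT.
- exact: mi.
Qed.

(** The powers of 2 up to the largest one below or equal to [t] add up to the next power minus 1.
    This splits a truncated term into dyadic layers. *)
Lemma lt_pow2_sum (t l : nat) : (t < 2 ^ l)%N ->
  (t <= \sum_(j < l) 2 ^ j * (2 ^ j <= t))%N.
Proof.
elim: l => [|l IH]; first by rewrite expn0 ltnS leqn0 => /eqP ->.
rewrite big_ord_recr/= => tl.
have [tl'|/IH] := leqP (2 ^ l) t; last by rewrite muln0 addn0.
suff -> : (\sum_(j < l) 2 ^ j * (2 ^ j <= t) = (2 ^ l).-1)%N.
  by move: tl; rewrite expnS muln1; lia.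
rewrite predn_exp mul1n; apply: eq_bigr => j _.
by rewrite (leq_trans _ tl') ?muln1// leq_exp2l// ltnW.
Qed.

(* Markov's inequality for the sum of the terms truncated at [2 ^ l]. *)
Lemma unif_sum_term_ge (R : realType) (N l : nat) (a : R) : 0 < a ->
  (unif R [set x | (a <= (\sum_(n < N) term x n)%:~R)%R] <=
    (N%:R / 2 ^+ l + (N * l)%:R / a)%:E)%E.
Proof.
move=> a0.
pose Bn n : set R := [set x : R | 2 ^+ l <= (term x n)%:~R :> R].
pose B : set R := \big[setU/set0]_(n < N) Bn n.
pose E (p : 'I_N * 'I_l) : set R :=
  [set x : R | 2 ^+ p.2 <= (term x p.1)%:~R :> R].
have mt n (c : R) := measurable_ge c (@measurable_term R n).
have mB : measurable B by apply: bigsetU_measurable => n _; exact: mt.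
have mE p : measurable (E p) by exact: mt.
(* Outside [B] all terms are below [2 ^+ l], and [W] dominates their sum. Each of its [N * l] layers
   has expectation at most 1, while [B] has measure at most [N%:R / 2 ^+ l]. *)
pose W x : R := \sum_p 2 ^+ (val p.2) * \1_(E p) x.
have mW : measurable [set x | a <= W x].
  apply: measurable_ge; apply: measurable_sum => p.
  by apply: measurable_funM => //; exact: measurable_indic.
have mS := measurable_ge a (@measurable_sum_term R N).
apply: (@le_trans _ _ (unif R (B `|` [set x | a <= W x]))).
  apply: le_unif => //; first exact: measurableU.
  move=> x /= ax; apply: contrapT => /not_orP[nB nW]; apply: nW.
  rewrite (le_trans ax)// /W rmorph_sum/=.
  rewrite -(pair_bigA _
    (fun (n : 'I_N) (j : 'I_l) => 2 ^+ j * \1_(E (n, j)) x))/=.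
  apply: ler_sum => n _.
  have : (term x n)%:~R < 2 ^+ l :> R.
    rewrite ltNge; apply/negP => h; apply: nB.
    by rewrite /B -bigcup_mkord; exists (val n) => //=.
  have := term_ge0 x n.
  case e : (term x n) => [t|//] _.
  rewrite -pmulrn -natrX ltr_nat => /lt_pow2_sum.
  rewrite -(ler_nat R) => /le_trans; apply.
  rewrite natr_sum; apply: ler_sum => j _.
  rewrite natrM natrX ler_pM2l ?exprn_gt0//.
  rewrite indicE ler_nat; case: (leqP (2 ^ j) t) => // h.
  by rewrite mem_set// /E/= e -pmulrn -natrX ler_nat.
rewrite (le_trans (measureU2 _ _ _))// EFinD leeD//.
  apply: (le_trans (@Boole_inequality _ _ _ (unif R) Bn N (fun i _ => mt i _))).
  apply: (@le_trans _ _ (\sum_(n < N) (2 ^- l)%:E)%E).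
    apply: lee_sum => n _; have p0 : 0 < 2 ^+ l :> R by rewrite exprn_gt0.
    exact: unif_term_ge p0.
  by rewrite sumEFin sumr_const card_ord mulr_natl.
rewrite -(@lee_pmul2l _ a%:E)// ?lte_fin// -EFinM mulrC divfK ?gt_eqF//.
apply: (le_trans (unif_markov a0 _ mE)) => [p|]; first by rewrite exprn_ge0.
apply: (@le_trans _ _ (\sum_(p : 'I_N * 'I_l) 1%:E)%E).
  apply: lee_sum => p _; have p0 : 0 < 2 ^+ p.2 :> R by rewrite exprn_gt0.
  rewrite -(fineK (unif_fin (mE p))) -EFinM lee_fin mulrC -ler_pdivlMr// div1r.
  by rewrite -lee_fin fineK ?unif_fin//; exact: unif_term_ge p0.
by rewrite sumEFin sumr_const card_prod !card_ord.
Qed.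

(** * Consequences of the convergence of the series of inverses *)

Lemma bounded_sum_cvg_series (R : realType) (u : nat -> R) (C : R) :
  (forall n, 0 <= u n) -> (forall n, \sum_(i < n) u i <= C) ->
  cvg (series u @ \oo).
Proof.
move=> u0 uC; apply: nondecreasing_is_cvgn.
  by apply: nondecreasing_series => n _ _; exact: u0.
by exists C => _ [n _ <-]; rewrite /series/= big_mkord.
Qed.

Lemma bounded_sum_inv_cvgy (R : realType) (G : nat -> R) (C : R) :
  (forall n, 0 < G n) -> (forall n, \sum_(i < n) (G i)^-1 <= C) ->
  forall c : R, exists m, forall n, (m <= n)%N -> c <= G n.
Proof.
move=> G0 GC c.
have := bounded_sum_cvg_series (fun n => ltW (etrans (invr_gt0 _) (G0 n))) GC.
move=> /cvg_series_cvg_0/cvgrPdist_lt.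
have c0 : 0 < (`|c| + 1)^-1 by rewrite invr_gt0 ltr_wpDl.
move=> /(_ _ c0)[m _ hm]; exists m => n mn.
have := hm n mn; rewrite /= sub0r normrN gtr0_norm ?invr_gt0//.
rewrite ltf_pV2 ?posrE ?ltr_wpDl// => h.
by rewrite (le_trans (ler_norm c))// ltW// (le_lt_trans _ h)// lerDl.
Qed.

(** Otherwise each dyadic block [m >= m0] contributes at least [(K * m.+1%:R)^-1] to the sum of
    inverses, and the harmonic series would converge. *)
Lemma exists_large_in_block (R : realType) (G : nat -> R) (C K : R) (m0 : nat) :
  (forall n, 0 < G n) -> (forall n, \sum_(i < n) (G i)^-1 <= C) -> 0 < K ->
  exists m i, [/\ (m0 <= m)%N, (2 ^ m <= i < 2 ^ m.+1)%N &
    K * 2 ^+ m * m.+1%:R <= G i].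
Proof.
move=> G0 GC K0; apply: contrapT => h.
have Gle m i : (m0 <= m)%N -> (2 ^ m <= i < 2 ^ m.+1)%N ->
    G i <= K * 2 ^+ m * m.+1%:R.
  move=> mm mi; rewrite leNgt; apply/negP => Gi; apply: h.
  by exists m, i; split => //; exact: ltW.
have block k : \sum_(i < k) harmonic (m0 + i)%N <=
    K * \sum_(0 <= i < 2 ^ (m0 + k)) (G i)^-1.
  elim: k => [|k IH].
    rewrite big_ord0 mulr_ge0 ?(ltW K0)//; apply: sumr_ge0 => i _.
    by rewrite invr_ge0 ltW.
  rewrite big_ord_recr/= addnS.
  have le2 : (2 ^ (m0 + k) <= 2 ^ (m0 + k).+1)%N by rewrite leq_exp2l.
  have -> : \sum_(0 <= i < 2 ^ (m0 + k).+1) (G i)^-1 =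
    \sum_(0 <= i < 2 ^ (m0 + k)) (G i)^-1 +
    \sum_(2 ^ (m0 + k) <= i < 2 ^ (m0 + k).+1) (G i)^-1 by exact: big_cat_nat.
  rewrite mulrDr lerD//.
  set m := (m0 + k)%N in le2 *.
  have m0m : (m0 <= m)%N by rewrite leq_addr.
  have : \sum_(2 ^ m <= i < 2 ^ m.+1) (K * 2 ^+ m * m.+1%:R)^-1 <=
      \sum_(2 ^ m <= i < 2 ^ m.+1) (G i)^-1.
    apply: ler_sum_nat => i mi; rewrite lef_pV2 ?posrE//; first exact: Gle.
    by rewrite !mulr_gt0// exprn_gt0.
  rewrite -(ler_pM2l K0); apply: le_trans.
  have p0 : 0 < 2 ^+ m :> R by rewrite exprn_gt0.
  have e2 : (2 ^ m.+1 - 2 ^ m = 2 ^ m)%N by rewrite expnS mul2n -addnn addnK.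
  rewrite sumr_const_nat e2 -(mulr_natr (_^-1)) natrX.
  rewrite /harmonic le_eqVlt; apply/orP; left; apply/eqP.
  by field; rewrite !gt_eqF.
apply: (@dvg_harmonic R).
apply: (@bounded_sum_cvg_series R harmonic
  (\sum_(i < m0) harmonic i + K * C)) => n.
  exact: harmonic_ge0.
rewrite (@le_trans _ _ (\sum_(i < m0 + n) harmonic i))//.
  rewrite [leRHS](_ : _ = \sum_(i < n + m0) harmonic i); last by rewrite addnC.
  by rewrite big_split_ord/= lerDl sumr_ge0// => i _; exact: harmonic_ge0.
rewrite big_split_ord/= lerD2l (le_trans (block n))// ler_pM2l// big_mkord.
exact: GC.
Qed.

(** Convergence to 0 in probability along a subsequence, at a summable rate so that Borel-Cantelli
    applies. *)
Lemma exists_sum_term_small (R : realType) (G : nat -> R) (C : R) :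
  (forall n, 0 < G n) -> (forall n, \sum_(i < n) (G i)^-1 <= C) ->
  forall j, exists n, (j <= n)%N /\
    (unif R [set x | (2 ^- j * G n <= (\sum_(i < n.+1) term x i)%:~R)%R] <=
      (4 / 2 ^+ j)%:E)%E.
Proof.
move=> G0 GC j.
(* One factor [2 ^+ j] offsets [2 ^- j] in the event, the other yields the rate, and [j.+1] serves
   for [m + j <= j.+1 * m.+1]. *)
have K0 : 0 < j.+1%:R * 4 ^+ j :> R by rewrite mulr_gt0// exprn_gt0.
have [m [n [jm /andP[mn nm] hG]]] := exists_large_in_block j G0 GC K0.
exists n; split.
  by rewrite (leq_trans _ mn)// (leq_trans jm)// ltnW// ltn_expl.
have a0 : 0 < 2 ^- j * G n by rewrite mulr_gt0// invr_gt0 exprn_gt0.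
(* As [n.+1 <= 2 ^ m.+1], truncation at [2 ^ (m + j)] fails with probability at most
   [2 / 2 ^+ j]. *)
apply: (le_trans (unif_sum_term_ge n.+1 (m + j) a0)); rewrite lee_fin.
have p0 k : 0 < 2 ^+ k :> R by rewrite exprn_gt0.
have n2 : n.+1%:R <= 2 * 2 ^+ m :> R by rewrite -exprS -natrX ler_nat.
have h1 : n.+1%:R / 2 ^+ (m + j) <= 2 / 2 ^+ j :> R.
  by rewrite ler_pdivrMr// exprD (mulrC (2 ^+ m)) mulrA divfK ?gt_eqF.
have h2 : (n.+1 * (m + j))%:R / (2 ^- j * G n) <= 2 / 2 ^+ j :> R.
  rewrite ler_pdivrMr//.
  apply: (@le_trans _ _
    (2 / 2 ^+ j * (2 ^- j * (j.+1%:R * 4 ^+ j * 2 ^+ m * m.+1%:R)))).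
    have -> : 4 ^+ j = 2 ^+ j * 2 ^+ j :> R.
      by rewrite -exprMn; congr (_ ^+ _); lra.
    have -> : 2 / 2 ^+ j *
        (2 ^- j * (j.+1%:R * (2 ^+ j * 2 ^+ j) * 2 ^+ m * m.+1%:R)) =
        2 * 2 ^+ m * (j.+1 * m.+1)%:R :> R.
      by rewrite natrM; field; rewrite gt_eqF.
    by rewrite natrM ler_pM// ler_nat; nia.
  by rewrite !ler_pM2l// ?divr_gt0// invr_gt0.
by rewrite (le_trans (lerD h1 h2))// -mulrDl; lra.
Qed.

Lemma ae_sum_term_small (R : realType) (G : nat -> R) (C : R) :
  (forall n, 0 < G n) -> (forall n, \sum_(i < n) (G i)^-1 <= C) ->
  {ae @lebesgue_measure R, forall x : R, x \in `[0, 1[ ->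
    forall j0, exists j n, [/\ (j0 <= j)%N, (j0 <= n)%N &
      (\sum_(i < n.+1) term x i)%:~R <= 2 ^- j * G n]}.
Proof.
move=> G0 GC; have [N hN] := choice (exists_sum_term_small G0 GC).
have mA j : measurable
    [set x : R | 2 ^- j * G (N j) <= (\sum_(i < (N j).+1) term x i)%:~R].
  by apply: measurable_ge; exact: measurable_sum_term.
have bC n : \sum_(j < n) 4 / 2 ^+ j <= 8 :> R.
  suff -> : \sum_(j < n) 4 / 2 ^+ j = 8 - 8 / 2 ^+ n :> R.
    by rewrite gerBl divr_ge0// exprn_ge0.
  elim: n => [|n IH]; first by rewrite big_ord0 expr0 divr1 subrr.
  rewrite big_ord_recr/= IH exprS invfM; lra.
apply: (ae_imp (ae_eventually_not mA (fun j => (hN j).2) bC)) => x h x01 j0.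
have [m hm] := h x01.
exists (maxn j0 m), (N (maxn j0 m)); split.
- exact: leq_maxl.
- exact: leq_trans (leq_maxl _ _) (hN _).1.
- by rewrite ltW// ltNge; apply/negP; apply: hm; exact: leq_maxr.
Qed.

Lemma ae_term_small (R : realType) (G : nat -> R) (C : R) :
  (forall n, 0 < G n) -> (forall n, \sum_(i < n) (G i)^-1 <= C) ->
  {ae @lebesgue_measure R, forall x : R, forall K : nat, x \in `[0, 1[ ->
    exists m, forall n, (m <= n)%N -> K.+1%:R * (term x n)%:~R <= G n}.
Proof.
move=> G0 GC; apply: ae_foralln => K.
have K0 : 0 < K.+1%:R :> R by [].
have GK n : 0 < G n / K.+1%:R by rewrite divr_gt0.
have mA n := measurable_ge (G n / K.+1%:R) (@measurable_term R n).
have Ab n := unif_term_ge n (GK n).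
have bC n : \sum_(i < n) (G i / K.+1%:R)^-1 <= K.+1%:R * C.
  under eq_bigr do rewrite invf_div.
  by rewrite -mulr_sumr ler_pM2l.
apply: (ae_imp (ae_eventually_not mA Ab bC)) => x h x01.
have [m hm] := h x01; exists m => n mn.
rewrite mulrC -ler_pdivlMr// leNgt; apply/negP => ?; apply: (hm n mn).
exact: ltW.
Qed.

(** * The dichotomy *)

(* For [G n = F n.+1 + 1 -> oo], this is the set of all [x] such that
   [S_N / F_N -> 0]; adding 1 only serves to bound [G] away from 0. *)
Definition small_sums (R : realType) (G : nat -> R) : set R :=
  [set x | forall K : nat, exists m, forall n, (m <= n)%N ->
    K.+1%:R * (\sum_(i < n.+1) term x i)%:~R <= G n].

Lemma measurable_small_sums (R : realType) (G : nat -> R) :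
  measurable (small_sums G).
Proof.
have -> : small_sums G = \bigcap_K \bigcup_m \bigcap_(n in [set n | (m <= n)%N])
    [set x | 0 <= G n - K.+1%:R * (\sum_(i < n.+1) term x i)%:~R].
  apply/seteqP; split=> x h K; have := h K.
    by move=> [m hm] _; exists m => // n mn /=; rewrite subr_ge0 hm.
  by move=> /(_ Logic.I)[m _ hm]; exists m => n /hm /=; rewrite subr_ge0.
apply: bigcap_measurableType => K _; apply: bigcup_measurable => m _.
apply: bigcap_measurableType => n _; apply: measurable_ge.
apply: measurable_funB => //; apply: measurable_funM => //.
exact: measurable_sum_term.
Qed.

(** Changing the terms before [k] alters the sums by a bounded amount, which is negligible as [G]
    tends to infinity. *)
Lemma small_sums_ext (R : realType) (G : nat -> R) (k : nat) (x y : R) :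
  (forall c : R, exists m, forall n, (m <= n)%N -> c <= G n) ->
  (forall n, (k <= n)%N -> term y n = term x n) ->
  small_sums G x -> small_sums G y.
Proof.
move=> Gy e Zx K.
(* One half of [G n] is reserved for the sum at [x], the other for the initial terms at [y]. *)
have [m1 h1] := Zx K.*2.+1.
pose c : R := (\sum_(i < k) term y i)%:~R.
have [m2 h2] := Gy (2 * (K.+1%:R * c)).
exists (maxn k (maxn m1 m2)) => n; rewrite !geq_max => /and3P[kn m1n m2n].
have Syx : \sum_(i < n.+1) term y i <=
    \sum_(i < k) term y i + \sum_(i < n.+1) term x i.
  have [d ->] : exists d, n.+1 = (k + d)%N.
    by exists (n.+1 - k)%N; rewrite subnKC// ltnW.
  rewrite !big_split_ord/= lerD2l.
  under eq_bigr do rewrite e ?leq_addr//.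
  by rewrite lerDr sumr_ge0// => i _; exact: term_ge0.
have {}Syx : (\sum_(i < n.+1) term y i)%:~R <=
    c + (\sum_(i < n.+1) term x i)%:~R :> R by rewrite /c -intrD ler_int.
rewrite (le_trans (ler_wpM2l _ Syx))// mulrDr.
have := h1 n m1n; have := h2 n m2n.
rewrite (_ : K.*2.+2%:R = 2 * K.+1%:R :> R); last first.
  by rewrite -natrM mul2n doubleS.
by rewrite -mulrA => *; lra.
Qed.

Lemma periodic_small_sums (R : realType) (G : nat -> R) (k : nat) :
  (forall c : R, exists m, forall n, (m <= n)%N -> c <= G n) ->
  periodic (2 ^- k) (small_sums G).
Proof.
by move=> Gy x; split; apply: (small_sums_ext (k := k) Gy) => n kn;
  rewrite term_translate.
Qed.

Lemma small_sums_cvg0 (R : realType) (F : nat -> R) (delta : R -> nat -> bool)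
    (x : R) : (forall N, (0 < N)%N -> 0 < F N) ->
  (forall c : R, exists m, forall n, (m <= n)%N -> c <= F n.+1 + 1) ->
  small_sums (fun n => F n.+1 + 1) x -> trimmed_avg F delta x @ \oo --> (0 : R).
Proof.
move=> F0 Fy Zx; apply/cvgrPdist_le => e e0.
(* The 2 in [2 / e] absorbs [F n.+1 + 1 <= 2 * F n.+1], which holds once [F n.+1 >= 1]. *)
have [m1 h1] := Zx (Num.truncn (2 / e)).
have [m2 h2] := Fy 2.
exists (maxn m1 m2).+1 => // -[//|n] /=; rewrite ltnS geq_max => /andP[m1n m2n].
have FN : 0 < F n.+1 by exact: F0.
have A0 : 0 <= trimmed_avg F delta x n.+1.
  apply: le_trans (trimmed_avg_ge delta x FN).
  by rewrite divr_ge0 ?ler0z ?trimmed_ge0// ltW.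
rewrite sub0r normrN ger0_norm// (le_trans (trimmed_avg_le _ _ FN))//.
rewrite ler_pdivrMr//.
have := h1 n m1n; have := h2 n m2n; have := truncnS_gt (2 / e).
rewrite ltr_pdivrMr//; set K := (Num.truncn _).+1%:R => hK F2 hS.
have S0 : 0 <= (\sum_(i < n.+1) term x i)%:~R :> R.
  by rewrite ler0z sumr_ge0// => i _; exact: term_ge0.
set S := (\sum_(i < n.+1) term x i)%:~R in hS S0 *.
rewrite -(ler_pM2l (_ : 0 < K))// (le_trans hS)//.
have : 2 * F n.+1 <= K * e * F n.+1 by rewrite ler_pM2r// ltW.
by rewrite mulrA => *; lra.
Qed.

Lemma cvg_small_sums (R : realType) (F : nat -> R) (delta : R -> nat -> bool)
    (x : R) : (forall N, (0 < N)%N -> 0 < F N) ->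
  (forall c : R, exists m, forall n, (m <= n)%N -> c <= F n.+1 + 1) ->
  nondyadic x ->
  (forall K : nat, exists m, forall n, (m <= n)%N ->
    K.+1%:R * (term x n)%:~R <= F n.+1 + 1) ->
  (forall j0, exists j n, [/\ (j0 <= j)%N, (j0 <= n)%N &
    (\sum_(i < n.+1) term x i)%:~R <= 2 ^- j * (F n.+1 + 1)]) ->
  cvg (trimmed_avg F delta x @ \oo) -> small_sums (fun n => F n.+1 + 1) x.
Proof.
move=> F0 Fy ndx hterm hsum /cvg_ex[/= c Ac].
have Fgt0 n : 0 < F n.+1 by exact: F0.
have [m2 h2] := Fy 2.
(* If [c > 0], the averages eventually exceed [c / 2], but along the indices from [hsum] even the
   untrimmed ones are at most [c / 2]: take [2 ^- j < c / 4] and [F n.+1 + 1 <= 2 * F n.+1]. *)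
have c0 : c <= 0.
  rewrite leNgt; apply/negP => c0.
  have /cvgrPdist_lt/(_ _ (divr_gt0 c0 (ltr0n R 2)))[m1 _ h1] := Ac.
  have c4 : 0 < c / 4 by rewrite divr_gt0.
  have [m3 _ h3] := near_infty_natSinv_expn_lt (PosNum c4).
  have [j [n []]] := hsum (maxn m1 (maxn m2 m3)).
  rewrite !geq_max => /and3P[_ _ m3j] /and3P[m1n m2n _] hS.
  have := h1 n.+1 (leqW m1n); have := h3 j m3j; rewrite /= div1r => hj.
  rewrite ltr_norml => /andP[_]; apply/negP; rewrite -leNgt.
  have := trimmed_avg_le delta x (Fgt0 n).
  have : (\sum_(i < n.+1) term x i)%:~R / F n.+1 <= c / 2.
    rewrite ler_pdivrMr// (le_trans hS)//.
    have F2 := h2 n m2n.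
    have : 2 ^- j * (F n.+1 + 1) <= c / 4 * (F n.+1 + 1).
      by rewrite ler_wpM2r ?ltW// (lt_le_trans _ F2).
    have : c / 4 * (F n.+1 + 1) <= c / 4 * (2 * F n.+1).
      by rewrite ler_pM2l//; lra.
    by lra.
  by lra.
move=> K; have K0 : 0 < K.+1%:R :> R by [].
(* The bound of [sum_le_trimmed], multiplied by [K.+1], has three parts: three trimmed sums, the
   constant 1 and the last term. Each is made at most a third of [F n.+1 + 1], whence the 9,
   [3 * K.+1] and [3 * K + 2]. *)
have e0 : 0 < (9 * K.+1%:R)^-1 :> R by rewrite invr_gt0 mulr_gt0.
have /cvgrPdist_lt/(_ _ e0)[m1 _ h1] := Ac.
have [m3 h3] := hterm (3 * K + 2)%N.
have [m4 h4] := Fy (3 * K.+1%:R).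
exists (maxn m1 (maxn m3 m4)) => n; rewrite !geq_max => /and3P[m1n m3n m4n].
have := h1 n.+1 (leqW m1n); rewrite /= ltr_norml => /andP[hA _].
have hT : (trimmed x n.+1)%:~R / F n.+1 < (9 * K.+1%:R)^-1.
  apply: le_lt_trans (trimmed_avg_ge delta x (Fgt0 n)) _.
  by move: hA; move: (_^-1) (trimmed_avg _ _ _ _) => u v *; lra.
rewrite ltr_pdivrMr// ltr_pdivlMl in hT; last by rewrite mulr_gt0.
have := sum_le_trimmed n ndx; rewrite -(ler_int R) !intrD intrM.
rewrite (_ : 3%:~R = 3 :> R)// (_ : 1%:~R = 1 :> R)// => hS.
rewrite -(ler_pM2l K0) in hS; rewrite (le_trans hS)//.
have := h4 n m4n; have := h3 n m3n.
rewrite (_ : (3 * K + 2).+1%:R = 3 * K.+1%:R :> R); last first.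
  by rewrite -natrM; congr _%:R; lia.
by rewrite !mulrDr => *; lra.
Qed.

(* MathComp-Analysis.  R/Z is represented by its fundamental domain [0, 1[. *)
Theorem theorem4 (R : realType) (F : nat -> R)
    (F_gt0 : forall N : nat, (0 < N)%N -> 0 < F N)
    (delta : R -> nat -> bool) :
  {ae @lebesgue_measure R, forall x : R, x \in `[0, 1[ ->
     ~ cvg (trimmed_avg F delta x @ \oo)} \/
  {ae @lebesgue_measure R, forall x : R, x \in `[0, 1[ ->
     trimmed_avg F delta x @ \oo --> (0 : R)}.
Proof.
pose G n := F n.+1 + 1.
have G0 n : 0 < G n by rewrite addr_gt0// F_gt0.
have [[C GC]|unbounded] :=
    pselect (exists C : R, forall n, \sum_(i < n) (G i)^-1 <= C); last first.
  left; apply: ae_diverge => // c; apply: contrapT => h; apply: unbounded.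
  by exists c => n; rewrite leNgt; apply/negP => cn; apply: h; exists n.
have Gy := bounded_sum_inv_cvgy G0 GC.
have cvgP : {ae @lebesgue_measure R, forall x : R, x \in `[0, 1[ ->
    cvg (trimmed_avg F delta x @ \oo) -> small_sums G x}.
  apply: (ae_imp2 (ae_imp2 (@ae_nondyadic R) (ae_term_small G0 GC)
    (S := fun x => x \in `[0, 1[ -> nondyadic x /\ forall K : nat, exists m,
      forall n, (m <= n)%N -> K.+1%:R * (term x n)%:~R <= G n) _)
    (ae_sum_term_small G0 GC)).
    by move=> x h1 h2 x01; split=> [|K]; [exact: h1|exact: h2].
  move=> x h1 h2 x01 cA; have [ndx ht] := h1 x01.
  exact: cvg_small_sums F_gt0 Gy ndx ht (h2 x01) cA.
(* Up to null sets, convergence to any limit forces [x] into [small_sums G], and membership implies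
   the limit 0; the zero-one law therefore decides between the two alternatives. *)
have mZ := measurable_small_sums G.
have [Z0|Z1] := zero_one_periodic mZ (fun k => periodic_small_sums k Gy).
- left; apply: (ae_imp2 cvgP (ae_unif_eq0 mZ Z0)) => x h1 h2 x01 /(h1 x01).
  exact: h2.
- right; apply: (ae_imp (ae_unif_eq0 (measurableC mZ) Z1)) => x h x01.
  by apply: small_sums_cvg0 => //; apply: contrapT; exact: h.
Qed.
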